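(* If a topological space $X$ has countable strong fan tightness, then each potentially bounded $\infty$-convex subset $\mathcal F\subset SC_p(X)$ is weakly discontinuous and has network weight $nw(\mathcal F)\le nw(X)$.
   Context: A function $f:X\to\mathbb R$ is scatteredly continuous if for each non-empty subset $A\subset X$ the restriction $f|A$ has a point of continuity. $SC_p(X)$ is the linear space of all scatteredly continuous real-valued functions on $X$, with the topology of pointwise convergence (inherited from $\mathbb R^X$). $X$ has countable strong fan tightness if for each sequence $(A_n)_{n\in\omega}$ of subsets of $X$ and each point $a\in\bigcap_{n\in\omega}\bar A_n$ there are points $a_n\in A_n$, $n\in\omega$, such that $a$ lies in the closure of $\{a_n\}_{n\in\omega}$. A subset $B$ of a (real) linear topological space $L$ is bounded if for each neighborhood $U\subset L$ of zero there is $n\in\mathbb N$ with $B\subset nU$. $B$ is potentially bounded if for each sequence $(x_n)_{n\in\omega}$ of points of $B$ there is a sequence $(t_n)_{n\in\omega}$ of positive reals such that $\{t_nx_n\}_{n\in\omega}$ is bounded in $L$. A subset $K$ of $L$ is $\infty$-convex if for each sequence $(x_n)_{n\in\omega}$ in $K$ that is bounded in $L$ and each sequence $(t_n)_{n\in\omega}$ of non-negative reals with $\sum_{n=0}^\infty t_n=1$ the series $\sum_{n=0}^\infty t_nx_n$ converges to a point of $K$. These notions are applied with $L=SC_p(X)$. A family $\mathcal F$ of real-valued functions on $X$ is weakly discontinuous if each non-empty subset $A\subset X$ contains a subset $U\subset A$, open and dense in $A$, such that $f|U$ is continuous for every $f\in\mathcal F$. The network weight $nw(Y)$ of a space $Y$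 is the smallest cardinality of a network of the topology of $Y$ (a network is a family $\mathcal N$ of subsets of $Y$ such that for every open $W\subset Y$ and $y\in W$ there is $N\in\mathcal N$ with $y\in N\subset W$). $\mathcal F$ carries the topology of pointwise convergence.
   Formalization: Network weight is taken as the maximum of the smallest cardinality of a network and ω; with the literal minimum the inequality fails, e.g. for X a point and the family [0,1] in SC_p(X) = ℝ, where nw(F) = ω > 1 = nw(X). *)

(* Defs.v *)
From HB Require Import structures.
From mathcomp Require Import all_boot all_order all_algebra.
From mathcomp Require Import all_classical all_reals all_analysis.

Set Implicit Arguments.
Unset Strict Implicit.
Unset Printing Implicit Defensive.

Import Order.TTheory GRing.Theory Num.Theory.
Import numFieldNormedType.Exports.

Local Open Scope classical_set_scope.
Local Open Scope card_scope.
Local Open Scope ring_scope.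

Definition countable_strong_fan_tightness (X : topologicalType) :=
  forall (A : nat -> set X) (a : X), (forall n, closure (A n) a) ->
    exists2 s : nat -> X, (forall n, A n (s n)) & closure (range s) a.

Definition scatteredly_continuous (X Y : topologicalType) (f : X -> Y) :=
  forall A : set X, A !=set0 ->
    exists2 a, A a & {for a, continuous (from_subspace A f)}.

(* [dense (U : set (subspace A))] would be wrong here: [subspace A] is a
   topology on all of [X] in which the points outside [A] are isolated. *)
Definition weakly_discontinuous (X Y : topologicalType) (F : set (X -> Y)) :=
  forall A : set X, A !=set0 ->
    exists U : set X, [/\ U `<=` A, open (U : set (subspace A)),
      A `<=` closure U & forall f, F f -> {within U, continuous f}].

Section linear_topological_space.
Context {R : realType} {L : topologicalLmodType R}.
Implicit Types B K : set L.

Definition tvs_bounded B := forall U : set L, nbhs 0 U ->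
  exists n : nat, B `<=` [set n%:R *: u | u in U].

Definition potentially_bounded B :=
  forall x : nat -> L, (forall n, B (x n)) ->
    exists2 t : nat -> R, (forall n, 0 < t n) &
      tvs_bounded (range (fun n => t n *: x n)).

Definition infty_convex K :=
  forall x : nat -> L, (forall n, K (x n)) -> tvs_bounded (range x) ->
  forall t : nat -> R, (forall n, 0 <= t n) -> series t @ \oo --> (1 : R) ->
    exists2 k, K k & series (fun n => t n *: x n) @ \oo --> k.

End linear_topological_space.

Section network_weight.
Variable Y : topologicalType.
Implicit Types N : set (set Y).

Definition network N :=
  forall (W : set Y) (y : Y), open W -> W y ->
    exists2 P, N P & P y /\ P `<=` W.

Definition minimal_network N :=
  network N /\ forall N', network N' -> N #<= N'.

(* The network weight, as a set of that cardinality: the disjoint union of a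
   network of least cardinality and the naturals. The second summand is the
   usual convention that cardinal functions take infinite values. *)
Definition nw : set (set Y + nat)%type :=
  (inl @` xget set0 minimal_network) `|` range inr.

End network_weight.

Arguments nw Y : clear implicits.

Lemma ex_card_min (T : Type) (G : set (set T)) : G !=set0 ->
  exists2 A, G A & forall B, G B -> A #<= B.
Proof.
move=> [A0 GA0].
pose P (S : set (set T -> T)) :=
  (forall p A, S p -> G A -> A (p A)) /\
  (forall p q A, S p -> S q -> G A -> p A = q A -> p = q).
have [H FP Htot|S [[S1 S2] Smax]] := @Zorn_bigcup _ P.
  split=> [p A [Z HZ Zp] GA|p q A [Z HZ Zp] [Z' HZ' Zq] GA pq].
    exact: (FP _ HZ).1 Zp GA.
  have [ZZ'|Z'Z] := Htot _ _ HZ HZ'.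
    exact: (FP _ HZ').2 (ZZ' _ Zp) Zq GA pq.
  exact: (FP _ HZ).2 Zp (Z'Z _ Zq) GA pq.
have [[A GA AS]|nA] := pselect (exists2 A, G A & A `<=` (fun p => p A) @` S).
  exists A => // B GB.
  apply: card_le_trans (card_le_trans (subset_card_le AS) (card_image_le _ _)) _.
  have injB : {in S &, injective (fun p : set T -> T => p B)}.
    by move=> p q /set_mem Sp /set_mem Sq; exact: S2.
  rewrite -(card_le_eql (inj_card_eq injB)); apply: subset_card_le => _ [p Sp <-].
  exact: S1 p B Sp GB.
have new A : G A -> exists2 a, A a & ~ ((fun p => p A) @` S) a.
  move=> GA; apply: contrapT => h; apply: nA; exists A => // a Aa.
  by apply: contrapT => nSa; apply: h; exists a.
have [a0 _ _] := new _ GA0.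
have [p0 p0P] : exists p0 : set T -> T,
    forall A, G A -> A (p0 A) /\ ~ ((fun p => p A) @` S) (p0 A).
  have /choice[p0 p0P] : forall A : set T, exists a,
      G A -> A a /\ ~ ((fun p => p A) @` S) a.
    move=> A; have [/new[a Aa Sa]|nGA] := pselect (G A); first by exists a.
    by exists a0.
  by exists p0.
exfalso; apply: (Smax (S `|` [set p0])).
  split; first exact: subsetUl.
  move=> /(_ p0 (or_intror erefl)) Sp0.
  by apply: (p0P _ GA0).2; exists p0.
split=> [p A [Sp|->] GA|p q A [Sp|->] [Sq|->] GA pq].
- exact: (S1 p A).
- exact: (p0P _ GA).1.
- exact: S2 pq.
- by case: (p0P _ GA).2; exists p.
- by case: (p0P _ GA).2; exists q.
- by [].
Qed.

Lemma minimal_networkP (Y : topologicalType) :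
  minimal_network (xget set0 (@minimal_network Y)).
Proof.
have [|N nN Nmin] := @ex_card_min _ (@network Y).
  by exists setT => W y _ Wy; exists W; last by split.
by apply: (@xgetPex _ set0 (@minimal_network Y)); exists N.
Qed.

Section SCp.
Variables (X : topologicalType) (R : realType).
Implicit Types f g : X -> R^o.

Let cont_at (A : set X) f (x : X) := f @ within A (nbhs x) --> f x.

Let scP f : scatteredly_continuous f <->
  forall A : set X, A !=set0 -> exists2 a, A a & cont_at A f a.
Proof.
split=> h A /h[a Aa fa]; exists a => //.
  by rewrite /cont_at nbhs_subspace_in.
by move: fa; rewrite /cont_at nbhs_subspace_in.
Qed.

Let sc_open f (A : set X) : scatteredly_continuous f -> A !=set0 ->
  exists U : set X, [/\ open U, (A `&` U) !=set0 &
    forall x, (A `&` U) x -> cont_at A f x].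
Proof.
move=> /scP scf A0; pose D := [set x | A x /\ ~ cont_at A f x].
apply: contrapT => nU.
have Ddense O : open O -> (A `&` O) !=set0 -> exists2 z, O z & D z.
  move=> oO AO; apply: contrapT => nz; apply: nU; exists O; split=> //.
  by move=> x [Ax Ox]; apply: contrapT => ncx; apply: nz; exists x.
have [z _ Dz] : exists2 z, [set: X] z & D z.
  by apply: Ddense; [exact: openT|rewrite setIT].
have [x [Ax ncx] cx] := scf D (ex_intro _ z Dz).
apply: ncx; apply/cvgrPdist_lt => e e0.
have e20 : 0 < e / 2 by rewrite divr_gt0.
move/cvgrPdist_lt : cx => /(_ _ e20).
rewrite near_withinE => /nbhs_interior nO.
rewrite near_withinE; near=> y => Ay; have : [set t | D t -> `|f x - f t| < e / 2]° y by near: y.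
set O := _° => Oy.
have [Dy|nDy] := pselect (D y).
  by apply: lt_trans (interior_subset Oy Dy) _; rewrite ltr_pdivrMr ?ltr_pMr// ltr1n.
have cy : cont_at A f y by apply: contrapT => h; apply: nDy.
move/cvgrPdist_lt : cy => /(_ _ e20).
rewrite near_withinE => /nbhs_interior nO'.
set O' := _° in nO'.
have [||v [Ov O'v] Dv] := Ddense (O `&` O').
- by apply: openI; exact: open_interior.
- by exists y; split=> //; split=> //; exact: nbhs_singleton nO'.
rewrite [ltRHS]splitr (le_lt_trans (ler_distD (f v) _ _))// ltrD//.
  exact: (interior_subset Ov).
by rewrite distrC; exact: (interior_subset O'v Dv.1).
Unshelve. all: by end_near. Qed.

Let sc_comb f g (h : X -> R^o) :
  (forall (A : set X) x, cont_at A f x -> cont_at A g x -> cont_at A h x) ->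
  scatteredly_continuous f -> scatteredly_continuous g ->
  scatteredly_continuous h.
Proof.
move=> fgh scf scg; apply/scP => A A0.
have [U [oU AU0 cf]] := sc_open scf A0.
have [a AUa cg] := (scP _).1 scg _ AU0.
exists a; first exact: AUa.1.
apply: fgh; first exact: cf.
have nU : nbhs a U by apply: open_nbhs_nbhs; split=> //; exact: AUa.2.
by move=> V /cg; apply: filterS2 nU => y Uy; rewrite /= => + Ay; apply.
Qed.

Definition SCp_pred : {pred X -> R^o} :=
  mem [set f | scatteredly_continuous f].

Lemma SCp_submod_closed : submod_closed SCp_pred.
Proof.
split=> [|c f g /set_mem scf /set_mem scg]; apply/mem_set.
  by apply/scP => A [a Aa]; exists a => //; exact: cvg_cst.
by apply: sc_comb scf scg => A x fx gx; apply: cvgD => //; exact: cvgZr.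
Qed.

HB.instance Definition _ :=
  GRing.isSubmodClosed.Build R (X -> R^o) SCp_pred SCp_submod_closed.

Record SCp : Type := MkSCp {
  SCp_fun :> X -> R^o;
  _ : SCp_fun \in SCp_pred }.

HB.instance Definition _ := [isSub for SCp_fun].
HB.instance Definition _ := [Choice of SCp by <:].
HB.instance Definition _ := [SubChoice_isSubLmodule of SCp by <:].
HB.instance Definition _ := Topological.copy SCp
  (initial_topology (SCp_fun : SCp -> {ptws X -> R^o})).

Lemma SCp_scatteredly_continuous (f : SCp) : scatteredly_continuous f.
Proof. by case: f => f /= /set_mem. Qed.

Lemma SCp_cvgP (G : set_system SCp) (f : SCp) : Filter G ->
  G --> f <-> forall x, (fun g : SCp => g x) @ G --> f x.
Proof.
move=> FG; rewrite -(@pointwise_cvgP _ R^o (SCp_fun @ G) f); split=> h.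
  exact: cvg_trans (cvg_app _ h) (@initial_continuous _ {ptws X -> R^o} _ f).
move=> V [_ [] [W oW <-] Wf WV]; apply: (filterS WV).
by apply: h; exact: open_nbhs_nbhs.
Qed.

Let SCp_eval x : continuous (fun f : SCp => f x).
Proof. by move=> f; exact: ((@SCp_cvgP (nbhs f) f _).1 cvg_id x). Qed.

Let SCp_add_continuous : continuous (fun p : SCp * SCp => p.1 + p.2).
Proof.
move=> -[f g]; apply/SCp_cvgP => x.
have fx : (fun p : SCp * SCp => p.1 x) @ (f, g) --> f x.
  exact: (cvg_comp fst (fun h : SCp => h x) cvg_fst (@SCp_eval x f)).
have gx : (fun p : SCp * SCp => p.2 x) @ (f, g) --> g x.
  exact: (cvg_comp snd (fun h : SCp => h x) cvg_snd (@SCp_eval x g)).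
exact: (cvgD fx gx).
Qed.

Let SCp_scale_continuous : continuous (fun p : R^o * SCp => p.1 *: p.2).
Proof.
move=> -[c f]; apply/SCp_cvgP => x.
have fx : (fun p : R^o * SCp => p.2 x) @ (c, f) --> f x.
  exact: (cvg_comp snd (fun h : SCp => h x) cvg_snd (@SCp_eval x f)).
exact: (cvgZ cvg_fst fx).
Qed.

HB.instance Definition _ :=
  PreTopologicalNmodule_isTopologicalNmodule.Build SCp SCp_add_continuous.
HB.instance Definition _ :=
  TopologicalNmodule_isTopologicalLmodule.Build R SCp SCp_scale_continuous.

End SCp.

(* Main.v *)
(** Suppose that no non-empty relatively open subset of some [A] makes all of [F]
    continuous. By countable tightness there are a countable set [Q = {q_n}] and [f_n] in [F]
    with [f_n|Q] discontinuous at [q_n]. Potential boundedness rescales the [f_n] to a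
    pointwise bounded sequence [h_n], and infinite convexity then makes every sum
    [\sum l_n h_(k n)] with [0 <= l_n <= 2^-(n+1)] scatteredly continuous. If the [h_n] were
    uniformly bounded on no relatively open piece of [Q], strong fan tightness would give such
    a sum that is locally unbounded at every point of a subset of [Q]; and on a piece where
    they are uniformly bounded, fast decreasing [l_n] give a sum discontinuous at every point.

    For the network weight, remove from [X] layer after layer open sets on which [F] is
    continuous. Cutting every element of a network of [X] down to a single layer gives as many
    sets, and they are fine enough to approximate every [f] in [F]; finite words in pairs of
    such a set and a rational interval then index a network of [F]. *)
Require Import Defs.
From mathcomp Require Import all_boot all_order all_algebra.
From mathcomp Require Import all_classical all_reals all_analysis.
From mathcomp Require Import ring lra.

Set Implicit Arguments.
Unset Strict Implicit.
Unset Printing Implicit Defensive.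

Local Open Scope classical_set_scope.
Local Open Scope card_scope.

(** * Cardinality of finite words over an infinite set *)

Section words.
Implicit Types T U : Type.

Lemma card_leI T U (A : set T) (B : set U) (f : T -> U) :
  set_fun A B f -> set_inj A f -> A #<= B.
Proof. by move=> fAB fI; apply: inj_card_le (unsquash (injfunPex.2 _)); exists f. Qed.

Lemma card_leE T U (A : set T) (B : set U) (b : U) : A #<= B ->
  exists2 f : T -> U, set_fun A B f & set_inj A f.
Proof.
by elim/Ppointed: U => U in B b *; [case: (no b)|move=> /pcard_leP/injfunPex].
Qed.

(** Without the empty word [words set0] is empty, so the Zorn argument below can start from the
    empty graph. *)
Definition words T (A : set T) : set (seq T) :=
  [set s | s <> [::] /\ all (fun x => x \in A) s].

Lemma card_le_words T U (A : set T) (B : set U) : A #<= B ->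
  words A #<= words B.
Proof.
have [[b _]|noU] := pselect (exists b : U, True); last first.
  move=> AB; suff -> : words A = set0 by exact: card_ge0.
  apply/seteqP; split=> // -[|a s] [//] _ /= /andP[/set_mem Aa _].
  move: AB => /card_leP[f]; apply: noU.
  by exists (val (f (SigSub (mem_set Aa)))).
move=> /(card_leE b)[f fAB fI]; apply: (@card_leI _ _ _ _ (map f)).
  move=> s [s0 As]; split; first by case: s s0 {As}.
  by rewrite all_map; apply: sub_all As => x /set_mem/fAB/mem_set.
move=> s t /set_mem[_ +] /set_mem[_]; elim: s t => [|a s IH] [|b' t]//=.
move=> /andP[Aa As] /andP[Ab At] [/(fI _ _ Aa Ab) -> /(IH _ As At) ->//].
Qed.

Lemma card_words_nat : words [set: nat] #<= [set: nat].
Proof. exact: card_le_trans (card_leT _) (countableP _). Qed.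

(* Prefixing each letter by one of two tags codes a word over [A `|` C] as a word over [A]. *)
Lemma card_words_setU T (A C : set T) (a b : T) : A a -> A b -> a <> b ->
  C #<= A -> words (A `|` C) #<= words A.
Proof.
move=> Aa Ab ab /(card_leE a)[f fCA fI].
pose w := fix w (s : seq T) := if s is x :: s' then
  (if x \in A then [:: a, x & w s'] else [:: b, f x & w s']) else [::].
apply: (@card_leI _ _ _ _ w).
  move=> s [s0 sAC]; split; first by case: s s0 {sAC} => //= x s _; case: ifP.
  elim: s sAC {s0} => //= x s IH /andP[/set_mem ACx /IH{}IH].
  case: ifPn => /= [->|/negP xA]; rewrite IH mem_set//= mem_set//.
  by apply: fCA; case: ACx => // /mem_set.
move=> s t /set_mem[_ +] /set_mem[_]; elim: s t => [|x s IH] [|y t]//=.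
- by case: ifP.
- by case: ifP.
move=> /andP[/set_mem ACx sAC] /andP[/set_mem ACy tAC].
case: ifPn => [_|/negP xA]; case: ifPn => [_|/negP yA] [].
- by move=> -> /(IH _ sAC tAC) ->.
- by move=> /ab.
- by move=> /esym/ab.
have [Cx Cy] : C x /\ C y by case: ACx => [/mem_set//|Cx]; case: ACy => [/mem_set|].
by move=> /(fI _ _ (mem_set Cx) (mem_set Cy)) -> /(IH _ sAC tAC) ->.
Qed.

Lemma card_le_total T (A B : set T) : A #<= B \/ B #<= A.
Proof.
have [|C [->|->] Cmin] := @ex_card_min _ [set A; B]; first by exists A; left.
- by left; apply: Cmin; right.
- by right; apply: Cmin; left.
Qed.

Variables (T : Type) (K : set T).

(** Read off from one-letter words, so that [G] alone carries a subset of [K] and its injection,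
    ordered by plain inclusion. *)
Let dom1 (G : set (seq T * T)) : set T := [set a | exists b, G ([:: a], b)].

(* [G] is the graph of an injection from [words (dom1 G)] to [dom1 G]. *)
Let good (G : set (seq T * T)) := [/\ dom1 G `<=` K,
  forall s b, G (s, b) -> words (dom1 G) s /\ dom1 G b,
  forall s, words (dom1 G) s -> exists b, G (s, b),
  forall s b c, G (s, b) -> G (s, c) -> b = c &
  forall s t b, G (s, b) -> G (t, b) -> s = t].

Let words_sub (A B : set T) : A `<=` B -> words A `<=` words B.
Proof.
by move=> AB s [s0 As]; split=> //; apply: sub_all As => x /set_mem/AB/mem_set.
Qed.

Let dom1_sub (G H : set (seq T * T)) : G `<=` H -> dom1 G `<=` dom1 H.
Proof. by move=> GH a [b /GH]; exists b. Qed.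

Let good_bigcup (F : set (set (seq T * T))) : F `<=` good ->
  total_on F subset -> good (\bigcup_(G in F) G).
Proof.
move=> Fgood Ftot; have sub G : F G -> G `<=` \bigcup_(G in F) G.
  exact: bigcup_sup.
have join G H p q : F G -> F H -> G p -> H q -> exists L, [/\ F L, L p & L q].
  move=> FG FH Gp Hq; have [GH|HG] := Ftot _ _ FG FH.
    by exists H; split=> //; exact: GH.
  by exists G; split=> //; exact: HG.
split.
- by move=> a [b [G FG Gab]]; have [h _ _ _ _] := Fgood _ FG; apply: h; exists b.
- move=> s b [G FG Gsb]; have [_ h _ _ _] := Fgood _ FG.
  have [ws bG] := h _ _ Gsb; split; last exact: dom1_sub (sub _ FG) _ bG.
  exact: words_sub (dom1_sub (sub _ FG)) _ ws.
- move=> s ws; suff [G FG Gs] : exists2 G, F G & words (dom1 G) s.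
    by have [_ _ /(_ _ Gs)[b Gsb] _ _] := Fgood _ FG; exists b, G.
  elim: s ws => [|a s IH] [//] _ /= /andP[/set_mem[b [G FG Gab]] Us].
  have Ga : dom1 G a by exists b.
  have [s0|s0] := pselect (s = [::]).
    by exists G => //; rewrite s0; split=> //=; rewrite mem_set.
  have [H FH [_ Hs]] := IH (conj s0 Us).
  have [GH|HG] := Ftot _ _ FG FH.
    by exists H => //; split=> //=; rewrite Hs andbT mem_set//; exact: dom1_sub GH _ Ga.
  exists G => //; split=> //=; rewrite mem_set//=.
  by apply: sub_all Hs => x /set_mem/(dom1_sub HG)/mem_set.
- move=> s b c [G FG Gp] [H FH Hp]; have [L [FL Lp Lq]] := join _ _ _ _ FG FH Gp Hp.
  by have [_ _ _ h _] := Fgood _ FL; exact: h Lp Lq.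
- move=> s t b [G FG Gp] [H FH Hp]; have [L [FL Lp Lq]] := join _ _ _ _ FG FH Gp Hp.
  by have [_ _ _ _ h] := Fgood _ FL; exact: h Lp Lq.
Qed.

(** Old words keep their values and new ones are injected into [B]; no values collide, as [B] misses
    [dom1 G]. *)
Let good_ext G (B : set T) : good G -> B !=set0 -> B `<=` K ->
  (forall x, B x -> ~ dom1 G x) -> words (dom1 G `|` B) #<= B ->
  exists2 H, good H & G `<` H.
Proof.
move=> [GK Gdom Gtot Gfun Ginj] [b0 Bb0] BK BG /(card_leE b0)[f fB fI].
set A := dom1 G in Gdom Gtot *.
pose H := G `|` [set p | [/\ words (A `|` B) p.1, ~ words A p.1 & p.2 = f p.1]].
have dH : dom1 H = A `|` B.
  apply/seteqP; split=> a.
    move=> [b [Gab|[/= [_ /=]]]]; first by left; exists b.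
    by rewrite andbT => /set_mem.
  move=> [[b Gab]|Ba]; first by exists b; left.
  exists (f [:: a]); right; split=> //=; first by split=> //=; rewrite mem_set//; right.
  by move=> [_ /=]; rewrite andbT => /set_mem/(BG _ Ba).
have fBw s : words (A `|` B) s -> B (f s) by exact: fB.
exists H; last first.
  split; first exact: subsetUl.
  move=> HG; apply: (BG _ Bb0); have : dom1 H b0 by rewrite dH; right.
  exact: dom1_sub HG _.
split; rewrite ?dH.
- by move=> a [/GK|/BK].
- move=> s b [/Gdom[ws bA]|[/= ws _ ->]]; split=> //; last by right; exact: fBw.
    exact: words_sub (@subsetUl _ A B) _ ws.
  by left.
- move=> s ws; have [wA|nwA] := pselect (words A s).
    by have [b Gsb] := Gtot _ wA; exists b; left.
  by exists (f s); right.
- move=> s b c [Gb|[/= ws nws ->]] [Gc|[/= ws' nws' ->]]//.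
  + exact: Gfun Gb Gc.
  + by case: nws'; have [] := Gdom _ _ Gb.
  + by case: nws; have [] := Gdom _ _ Gc.
- move=> s t b [Gb|[/= ws nws ->]] [Gc|[/= ws' nws' e]]//.
  + exact: Ginj Gb Gc.
  + have [_ bA] := Gdom _ _ Gb; case: (BG _ (fBw _ ws')).
    by rewrite -e.
  + have [_ bA] := Gdom _ _ Gc; by case: (BG _ (fBw _ ws)).
  + by apply: fI e; exact: mem_set.
Qed.

(** For a maximal [G] with [A = dom1 G], a copy of [A] outside [A] would extend [G]. So the rest of
    [K] injects into [A], and [words A] absorbs [K]. *)
Lemma card_words_infinite : infinite_set K -> words K #<= K.
Proof.
move=> Kinf; have [G [Ggood Gmax]] := Zorn_bigcup good_bigcup.
have noext B : B !=set0 -> B `<=` K -> (forall x, B x -> ~ dom1 G x) ->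
    words (dom1 G `|` B) #<= B -> False.
  move=> B0 BK BG /(good_ext Ggood B0 BK BG)[H gH GH].
  exact: Gmax GH gH.
have [GK Gdom Gtot Gfun Ginj] := Ggood.
set A := dom1 G in GK Gdom Gtot noext.
have [[a Aa]|A0] := pselect (A !=set0); last first.
  have /infinite_setN0[k Kk] := Kinf.
  move: Kinf => /infiniteP/(card_leE k)[f fK fI]; exfalso.
  have fE : f @` [set: nat] #= [set: nat] by exact: inj_card_eq.
  have A0' : A = set0 by apply: contrapT => /eqP/set0P/A0.
  apply: (noext (f @` [set: nat])).
  - by exists (f 0), 0.
  - by move=> _ [n _ <-]; exact: fK.
  - by move=> x _ Ax; apply: A0; exists x.
  rewrite A0' set0U (card_le_eqr fE).
  by apply: card_le_trans card_words_nat; apply: card_le_words; rewrite (card_le_eql fE).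
have wA : words A #<= A.
  have /choice[g gP] : forall s, exists b, words A s -> G (s, b).
    move=> s; have [/Gtot[b Gsb]|ns] := pselect (words A s); first by exists b.
    by exists a.
  apply: (@card_leI _ _ _ _ g) => [s /gP/Gdom[]//|s t /set_mem/gP sG /set_mem/gP tG].
  by move=> gst; move: tG; rewrite -gst => tG; exact: Ginj sG tG.
(* The images of [[:: a]] and [[:: a; a]] are distinct and serve as tags. *)
have [b [c [Ab Ac bc]]] : exists b c, [/\ A b, A c & b <> c].
  have w1 : words A [:: a] by split=> //=; rewrite mem_set.
  have w2 : words A [:: a; a] by split=> //=; rewrite mem_set.
  have [b Gb] := Gtot _ w1; have [c Gc] := Gtot _ w2.
  exists b, c; split; [by have [] := Gdom _ _ Gb|by have [] := Gdom _ _ Gc|].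
  by move=> bc; move: Gc; rewrite -bc => /(Ginj _ _ _ Gb).
have [AK|KA] := card_le_total A (K `\` A).
  exfalso; have [f fK fI] := card_leE a AK.
  have fE : f @` A #= A by exact: inj_card_eq.
  apply: (noext (f @` A)).
  - by exists (f a), a.
  - by move=> _ [x Ax <-]; have [] := fK _ Ax.
  - by move=> _ [x Ax <-] ; have [] := fK _ Ax.
  rewrite (card_le_eqr fE); apply: card_le_trans wA.
  by apply: card_words_setU Ab Ac bc _; rewrite (card_le_eql fE).
apply: card_le_trans (subset_card_le GK).
have -> : K = A `|` (K `\` A) by rewrite setDE setUIr setUv setIT; apply/esym/setUidPr.
apply: card_le_trans wA; exact: card_words_setU Ab Ac bc KA.
Qed.

End words.

(** * Series with controlled coefficients *)

Section series.
Import Order.TTheory GRing.Theory Num.Theory.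
Import numFieldNormedType.Exports.
Local Open Scope ring_scope.
Variable R : realType.
Implicit Types (a d : R^nat) (l : R).

(** Telescoping: beyond [m] the partial sums move by at most [d m - d n]. *)
Lemma series_tail_le a d m l : (forall k, 0 <= d k) ->
  (forall k, (m <= k)%N -> `|a k| <= d k - d k.+1) ->
  series a @ \oo --> l -> `|l - series a m| <= d m.
Proof.
move=> d0 ad al.
have tail n : `|series a (m + n)%N - series a m| <= d m - d (m + n)%N.
  elim: n => [|n IH]; first by rewrite addn0 !subrr normr0.
  rewrite addnS seriesSr.
  rewrite addrAC; apply: le_trans (ler_normD _ _) _.
  have := ad (m + n)%N (leq_addr _ _); lra.
have cn : `|series a n - series a m| @[n --> \oo] --> `|l - series a m|.
  by apply: cvg_norm; apply: cvgB => //; exact: cvg_cst.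
apply: (cvgr_to_le cn); near=> n.
have mn : (m <= n)%N by near: n; exact: nbhs_infty_ge.
rewrite -(subnKC mn); apply: le_trans (tail _) _.
by rewrite gerBl.
Unshelve. all: by end_near. Qed.

Lemma is_cvg_series_halves (a : R^nat) : (forall n, 0 <= a n <= 2^-1 ^+ n.+1) ->
  exists2 l, series a @ \oo --> l & l <= 1.
Proof.
move=> a01.
have le1 n : series a n <= 1 - 2^-1 ^+ n.
  elim: n => [|n IH]; first by rewrite /series/= big_geq// expr0 subrr.
  rewrite seriesSr; have := a01 n; rewrite exprS; lra.
have cv : cvgn (series a).
  apply: nondecreasing_is_cvgn.
    apply/nondecreasing_seqP => n; rewrite seriesSr lerDl.
    by have /andP[] := a01 n.
  exists 1 => _ [n _ <-]; apply: le_trans (le1 n) _.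
  by rewrite gerBl exprn_ge0.
exists (lim (series a @ \oo)) => //; apply: (limr_le cv); near=> n.
by apply: le_trans (le1 n) _; rewrite gerBl exprn_ge0.
Unshelve. all: by end_near. Qed.

(* Only the diagonal terms are kept under control: [l j] is either [16^-(j+1)] or [0],
   whichever makes the partial sum up to [j] large in column [j]. *)
Lemma series_dominant_diagonal (a : nat -> nat -> R) :
  (forall i j, `|a i j| <= 2 * `|a j j|) ->
  exists2 l : R^nat, (forall n, 0 <= l n <= 2^-1 ^+ n.+1) &
    forall (g : R^nat), (forall j, series (fun n => l n * a n j) @ \oo --> g j) ->
      forall j, 16^-1 ^+ j.+1 * `|a j j| <= 5 * `|g j|.
Proof.
(* Term [n] is taken only if the sum so far in column [n] is below half of the weighted diagonal
   entry. *)
move=> adom; pose lam n (S : nat -> R) : R :=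
  if `|S n| < 16^-1 ^+ n.+1 * `|a n n| / 2 then 16^-1 ^+ n.+1 else 0.
pose S := fix S n : nat -> R :=
  if n is m.+1 then fun j => S m j + lam m (S m) * a m j else fun=> 0.
pose l n := lam n (S n).
have p16 n : 0 < (16^-1 : R) ^+ n by rewrite exprn_gt0.
have l16 n : 0 <= l n <= 16^-1 ^+ n.+1.
  by rewrite /l /lam; case: ifP => _; rewrite lexx ?ltW.
exists l => [n|g gl j].
  have /andP[-> /le_trans->//] := l16 n.
  by rewrite lerXn2r ?nnegrE// lef_pV2 ?posrE// ler_nat.
have SE n : series (fun n => l n * a n j) n = S n j.
  by elim: n => [|n IH]; [rewrite /series/= big_geq|rewrite seriesSr IH].
(* The terms [k] after [j] are at most [c * (16^-k - 16^-(k+1))]. Their sum takes [2/15] from the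
   share [1/2] of the diagonal term, leaving more than [1/5]. *)
pose c := 2 * `|a j j| / 15.
have c0 : 0 <= c by rewrite divr_ge0 ?mulr_ge0.
have := @series_tail_le _ (fun n => c * 16^-1 ^+ n) j.+1 _ _ _ (gl j).
rewrite SE => tail.
have {}tail : `|g j - S j.+1 j| <= c * 16^-1 ^+ j.+1.
  apply: tail => [k|k _]; first by rewrite mulr_ge0// ltW.
  rewrite normrM exprS; have /andP[l0 lk] := l16 k; rewrite (ger0_norm l0).
  apply: le_trans (ler_pM l0 (normr_ge0 _) lk (adom k j)) _.
  rewrite exprS /c; lra.
have Sj : 16^-1 ^+ j.+1 * `|a j j| / 2 <= `|S j.+1 j|.
  rewrite /= /lam; case: ltP => [Slt|]; last by rewrite mul0r addr0.
  have := lerB_normD (16^-1 ^+ j.+1 * a j j) (S j j).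
  rewrite (addrC (S j j)) normrM (ger0_norm (ltW (p16 _))); lra.
have := lerB_dist (S j.+1 j) (g j); rewrite distrC.
have : 0 <= 16^-1 ^+ j.+1 * `|a j j| by rewrite mulr_ge0// ltW.
move: tail Sj; rewrite /c; lra.
Qed.

End series.

(** * Discontinuity as a jump, and sums that keep their jumps *)

Section jump.
Import Order.TTheory GRing.Theory Num.Theory.
Import numFieldNormedType.Exports.
Local Open Scope ring_scope.
Variables (X : topologicalType) (R : realType).
Implicit Types (A Q : set X) (f g : X -> R) (x : X) (e : R).

(** Stated as a closure, so that strong fan tightness applies to it directly. *)
Definition jump A f x e := closure (A `&` [set y | e <= `|f y - f x|]) x.

Lemma jumpPn A f x e : ~ jump A f x e ->
  \forall y \near x, A y -> `|f y - f x| < e.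
Proof.
move=> /existsNP[B /not_implyP[xB nB]]; apply: filterS xB => y By Ay.
by rewrite ltNge; apply/negP => ef; apply: nB; exists y.
Qed.

Lemma continuous_jumpP A (f : X -> R^o) x : A x ->
  {for x, continuous (from_subspace A f)} <-> forall e, 0 < e -> ~ jump A f x e.
Proof.
move=> Ax; suff: f @ within A (nbhs x) --> f x <->
    forall e, 0 < e -> ~ jump A f x e by rewrite nbhs_subspace_in.
split=> [/cvgrPdist_lt fx e e0 jx|nj].
  have [y [[Ay /= ey]]] := jx _ (fx e e0); rewrite /= distrC => /(_ Ay).
  by rewrite ltNge ey.
apply/cvgrPdist_lt => e e0; rewrite near_withinE.
by apply: filterS (jumpPn (nj e e0)) => y; rewrite distrC.
Qed.

Lemma scatteredly_continuous_no_jump (f : X -> R^o) A :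
  scatteredly_continuous f -> A !=set0 ->
  exists2 a, A a & forall e, 0 < e -> ~ jump A f a e.
Proof. by move=> fsc /fsc[a Aa /(continuous_jumpP _ Aa)]; exists a. Qed.

Lemma jump_open A (O : set X) f x e : open O -> O x -> jump A f x e ->
  jump (A `&` O) f x e.
Proof.
move=> oO Ox jx B xB; have [|y [[Ay ey] [By Oy]]] := jx (B `&` O).
  by apply: filterI => //; exact: open_nbhs_nbhs.
by exists y.
Qed.

Lemma jumpD A f g x e d : ~ jump A f x d -> jump A g x e ->
  jump A (fun y => f y + g y) x (e - d).
Proof.
move=> /jumpPn fd ge B xB.
have [y [[Ay ey] [By /(_ Ay) fy]]] := ge _ (filterI xB fd).
exists y; split=> //; split=> //=.
have -> : f y + g y - (f x + g x) = (g y - g x) + (f y - f x) by ring.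
by have := lerB_normD (g y - g x) (f y - f x); move: fy ey => /=; lra.
Qed.

Lemma jump_near A f g x e d : A x -> (forall y, A y -> `|g y - f y| <= d) ->
  jump A f x e -> jump A g x (e - 2 * d).
Proof.
move=> Ax fg fe B xB; have [y [[Ay /= ey] By]] := fe _ xB.
exists y; split=> //; split=> //=.
have := lerB_normD (f y - f x) ((g y - f y) - (g x - f x)).
have -> : f y - f x + (g y - f y - (g x - f x)) = g y - g x by ring.
have := ler_normB (g y - f y) (g x - f x); have := fg y Ay; have := fg x Ax.
lra.
Qed.

(* Keeping the terms at which the partial sum already jumps out of the sum, and all
   others small with respect to the jumps obtained before, no jump can cancel. *)
Lemma series_jump Q (u : nat -> X -> R) (p : nat -> X) M : 0 < M ->
  (forall n y, Q y -> `|u n y| <= M) -> (forall n, Q (p n)) ->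
  (forall n, exists2 e, 0 < e & jump Q (u n) (p n) e) ->
  exists2 l : R^nat, (forall n, 0 <= l n <= 2^-1 ^+ n.+1) &
    forall g, (forall y, Q y -> series (fun n => l n * u n y) @ \oo --> g y) ->
      forall n, exists2 e, 0 < e & jump Q g (p n) e.
Proof.
move=> M0 uM Qp uj.
(* [Sr] holds the partial sum and a bound for the next coefficient; [lr] holds that coefficient and
   the following bound, small against the jump at [p m]. *)
have step m (Sr : (X -> R) * R) : exists lr : R * R, 0 < Sr.2 ->
    [/\ 0 <= lr.1 <= Sr.2, 0 < lr.2 <= Sr.2 / 2 &
      jump Q (fun y => Sr.1 y + lr.1 * u m y) (p m) (8 * M * lr.2)].
  case: Sr => S r /=; have [r0|r0] := ltP 0 r; last by exists (0, 0); lra.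
  have [l l01 [e e0 je]] : exists2 l, 0 <= l <= r &
      exists2 e, 0 < e & jump Q (fun y => S y + l * u m y) (p m) e.
    have [[e [e0 je]]|nj] := pselect (exists e, 0 < e /\ jump Q S (p m) e).
      exists 0; first by rewrite lexx ltW.
      by exists e => //; under [X in jump _ X]funext do rewrite mul0r addr0.
    have [e e0 je] := uj m; exists r; first by rewrite lexx ltW.
    exists (r * e / 2); first by rewrite divr_gt0 ?mulr_gt0.
    have -> : r * e / 2 = r * e - r * e / 2 by lra.
    apply: jumpD => [j|B /je[y [[Qy /= ey] By]]].
      by apply: nj; exists (r * e / 2); rewrite divr_gt0 ?mulr_gt0.
    exists y; split=> //; split=> //=.
    by rewrite -mulrBr normrM gtr0_norm// ler_pM2l.
  exists (l, Num.min (r / 2) (e / (8 * M))) => _ /=; split=> //.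
    by rewrite lt_min ge_min lexx !divr_gt0 ?mulr_gt0.
  move=> B /je[y [[Qy /= ey] By]]; exists y; split=> //; split=> //=.
  apply: le_trans ey; rewrite -ler_pdivlMl ?mulr_gt0// [leRHS]mulrC.
  by rewrite ge_min lexx orbT.
have /choice[F FP] : forall mS : nat * ((X -> R) * R), exists lr : R * R, 0 < mS.2.2 ->
    [/\ 0 <= lr.1 <= mS.2.2, 0 < lr.2 <= mS.2.2 / 2 &
      jump Q (fun y => mS.2.1 y + lr.1 * u mS.1 y) (p mS.1) (8 * M * lr.2)].
  by move=> [m Sr]; exact: step.
pose st := fix st n : (X -> R) * R := if n is m.+1 then
  let lr := F (m, st m) in (fun y => (st m).1 y + lr.1 * u m y, lr.2) else (fun=> 0, 2^-1).
pose l n := (F (n, st n)).1; pose r n := (st n).2.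
have r0 n : 0 < r n.
  elim: n => [|n IH]; first by rewrite /r/= invr_gt0.
  by have [_ /andP[]] := FP (n, st n) IH.
have lr n : 0 <= l n <= r n by have [] := FP (n, st n) (r0 n).
have rS n : r n.+1 <= r n / 2 by have [_ /andP[]] := FP (n, st n) (r0 n).
have r2 n : r n <= 2^-1 ^+ n.+1.
  elim: n => [|n IH]; first by rewrite expr1.
  by rewrite exprS; have := rS n; lra.
have SE n y : series (fun k => l k * u k y) n = (st n).1 y.
  by elim: n => [|n IH]; [rewrite /series/= big_geq|rewrite seriesSr IH].
exists l => [n|g gl n].
  by have /andP[-> /le_trans->] := lr n.
have [_ _ jn] := FP (n, st n) (r0 n).
(* The bounds at least halve, so the remaining sum is at most [2 * M * r n.+1], and half of the jump
   survives. *)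
exists (8 * M * r n.+1 - 2 * (2 * M * r n.+1)).
  by have := mulr_gt0 M0 (r0 n.+1); lra.
apply: jump_near (Qp n) _ jn => y Qy.
have := @series_tail_le _ _ (fun k => 2 * M * r k) n.+1 _ _ _ (gl y Qy).
rewrite SE; apply=> k; first by rewrite !mulr_ge0 ?ltW.
move=> _; rewrite normrM; have /andP[l0 lk] := lr k; rewrite (ger0_norm l0).
apply: le_trans (ler_pM l0 (normr_ge0 _) lk (uM k y Qy)) _.
have : M * r k.+1 <= M * (r k / 2) by rewrite ler_pM2l.
lra.
Qed.

End jump.

(** * Boundedness and infinite convexity for pointwise convergence *)

Section SCp_theory.
Import Order.TTheory GRing.Theory Num.Theory.
Import numFieldNormedType.Exports.
Local Open Scope ring_scope.
Variables (X : topologicalType) (R : realType).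
Local Notation L := (SCp X R).
Implicit Types (B F : set L) (x : X).

Lemma SCpDE (f g : L) x : (f + g) x = f x + g x.
Proof. by []. Qed.

Lemma SCpZE (c : R) (f : L) x : (c *: f) x = c * f x.
Proof. by []. Qed.

Lemma SCp_seriesE (f : nat -> L) n x : series f n x = series (fun k => f k x) n.
Proof.
by elim: n => [|n IH]; [rewrite /series/= !big_geq|rewrite !seriesSr SCpDE IH].
Qed.

(** If no multiple of [U] contained [B], some [f n] in [B] would have [f n / (n+1)] outside [U], yet
    pointwise boundedness sends this sequence to zero. *)
Lemma tvs_boundedP B :
  tvs_bounded B <-> forall x, exists M, forall f, B f -> `|f x| <= M.
Proof.
have ev x : (fun f : L => f x) @ (0 : L) --> (0 : R).
  exact: ((@SCp_cvgP X R (nbhs (0 : L)) 0 _).1 cvg_id x).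
split=> [Bb x|Bb U U0].
  have /Bb[n nB] : nbhs (0 : L) [set f : L | `|f x| < 1].
    have /cvgr0Pnorm_lt := ev x; exact.
  exists n%:R => _ /nB[g /= gx <-].
  by rewrite SCpZE normrM normr_nat ler_piMr// ltW.
apply: contrapT => /forallNP nB.
have /choice[f fP] : forall n, exists f, B f /\ ~ U (n.+1%:R^-1 *: f).
  move=> n; apply: contrapT => /forallNP h; apply: (nB n.+1) => f Bf.
  have := h f; rewrite not_andP => -[//|/contrapT Uf]; exists (n.+1%:R^-1 *: f) => //.
  by rewrite scalerA divff ?scale1r// pnatr_eq0.
have /(_ U U0)[N _ /(_ N (leqnn N))] : (fun n => n.+1%:R^-1 *: f n) @ \oo --> (0 : L).
  apply/SCp_cvgP => x; have [M fM] := Bb x.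
  suff : (fun n => n.+1%:R^-1 * f n x) @ \oo --> (0 : R) by [].
  apply/cvgr0Pnorm_lt => e e0; near=> n.
  rewrite normrM normfV normr_nat mulrC ltr_pdivrMr ?ltr0n//.
  apply: le_lt_trans (fM _ (fP n).1) _; rewrite -ltr_pdivrMl//.
  near: n; apply: filterS (nbhs_infty_gtr (e^-1 * M)) => n /lt_trans; apply.
  by rewrite ltr_nat.
by have [] := fP N.
Unshelve. all: by end_near. Qed.

Lemma infty_convexP F (f : nat -> L) : infty_convex F -> (forall n, F (f n)) ->
  (forall x, exists M, forall n, `|f n x| <= M) ->
  forall t : R^nat, (forall n, 0 <= t n) -> series t @ \oo --> (1 : R) ->
  exists2 k, F k & forall x, series (fun n => t n * f n x) @ \oo --> k x.
Proof.
move=> Fconv Ff fb t t0 t1; have [|k Fk fk] := Fconv f Ff _ t t0 t1.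
  apply/tvs_boundedP => x; have [M fM] := fb x.
  by exists M => _ [n _ <-]; exact: fM.
exists k => // x; rewrite -[series _](_ : (fun n => series (fun n => t n *: f n) n x) = _).
  exact: (SCp_cvgP _ _).1 fk x.
by apply/funext => n; rewrite SCp_seriesE.
Qed.

Let eq_cvgn (u v : R^nat) (l m : R) : v =1 u -> m = l -> u @ \oo --> l -> v @ \oo --> m.
Proof. by move=> /funext-> ->. Qed.

Lemma series_recl (u : R^nat) n : series u n.+1 = u 0%N + series (u \o S) n.
Proof. by rewrite /series/= !big_mkord big_ord_recl. Qed.

(** Take the sequence [f, g, g, ...] with weights [1 - s, s, 0, ...]. *)
Lemma infty_convex_segment F (f g : L) (s : R) : infty_convex F -> F f -> F g ->
  0 <= s <= 1 -> F ((1 - s) *: f + s *: g).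
Proof.
move=> Fconv Ff Fg /andP[s0 s1].
pose h n := if n is _.+1 then g else f.
pose t n : R := match n with 0%N => 1 - s | 1%N => s | _ => 0 end.
have E (u : R^nat) n : series (fun n => t n * u n) n.+2 = (1 - s) * u 0%N + s * u 1%N.
  rewrite !series_recl [series _ _]big1 ?addr0// => i _; exact: mul0r.
have tc (u : R^nat) : series (fun n => t n * u n) @ \oo --> (1 - s) * u 0%N + s * u 1%N.
  rewrite -(cvg_shiftn 2)/=; apply: cvg_near_cst.
  by near=> n; rewrite addn2 E.
have [|x|n||k Fk hk] := @infty_convexP F h Fconv _ _ t.
- by case.
- exists (`|f x| + `|g x|) => -[|n] /=; rewrite ?lerDl ?lerDr//.
- by case: n => [|[|n]]//=; rewrite subr_ge0.
- apply: eq_cvgn (tc (fun=> 1)) => [n|]; last by rewrite !mulr1 subrK.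
  by apply: eq_bigr => i _; rewrite mulr1.
have -> : (1 - s) *: f + s *: g = k => //.
apply/val_inj/funext => x; apply: (cvg_unique (@norm_hausdorff _ R^o) (tc (h ^~ x)) (hk x)).
Unshelve. all: by end_near. Qed.

(** [t n *: f n] may leave [F], but mixing [f n] with [f 0] in proportion [t n] to [1 - t n] does
    not. The missing weight goes to [f 0], and a multiple of [f 0] is subtracted at the end, within
    the linear space. *)
Lemma infty_convex_series F (f : nat -> L) (t l : R^nat) : infty_convex F -> (forall n, F (f n)) ->
  (forall n, 0 < t n <= 1) ->
  (forall x, exists M, forall n, `|t n * f n x| <= M) ->
  (forall n, 0 <= l n <= 2^-1 ^+ n.+1) ->
  exists k : L, forall x, series (fun n => l n * (t n * f n x)) @ \oo --> k x.
Proof.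
move=> Fconv Ff t01 tf l01.
have [s ls s1] := is_cvg_series_halves l01.
have [|s' ls' _] := @is_cvg_series_halves _ (fun n => l n * t n).
  move=> n; have /andP[l0 ll] := l01 n; have /andP[/ltW t0 t1] := t01 n.
  by rewrite mulr_ge0//= (le_trans _ ll)// ler_piMr.
pose h n := if n is m.+1 then (1 - t m) *: f 0%N + t m *: f m else f 0%N.
have hE n x : h n.+1 x = (1 - t n) * f 0%N x + t n * f n x by [].
pose w n := if n is m.+1 then l m else 1 - s.
have [|x|n||k Fk hk] := @infty_convexP F h Fconv _ _ w.
- case=> [|m]; [exact: Ff|apply: infty_convex_segment => //].
  by have /andP[/ltW-> ->] := t01 m.
- have [M fM] := tf x; exists (`|f 0%N x| + `|M|) => -[|n]; first by rewrite lerDl.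
  rewrite hE; apply: le_trans (ler_normD _ _) _.
  apply: lerD; last exact: le_trans (fM n) (ler_norm _).
  have /andP[t0 t1] := t01 n.
  by rewrite normrM ler_piMl// ler_norml; lra.
- by case: n => [|n] /=; [rewrite subr_ge0|have /andP[] := l01 n].
- rewrite -(cvg_shiftn 1)/=.
  apply: eq_cvgn (cvgD (cvg_cst (1 - s)) ls) => [n|]; last by rewrite subrK.
  by rewrite addn1 series_recl.
(* In [k] the mixing contributes [f 0] with coefficient [(1 - s) + (s - s')]. *)
exists (k - (1 - s') *: f 0%N) => x; rewrite !SCpDE -scaleNr SCpZE.
move: (hk x); rewrite -(cvg_shiftn 1)/= => hkx.
apply: eq_cvgn (cvgB (cvgB hkx (cvg_cst ((1 - s) * f 0%N x)))
  (cvgM (cvgB ls ls') (cvg_cst (f 0%N x)))) => [n|]; last by ring.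
rewrite !fctE/= addn1 series_recl.
elim: n => [|n IH]; first by rewrite /series/= !big_geq//; ring.
rewrite !seriesSr IH.
rewrite [(_ \o _) _](_ : _ = l n * ((1 - t n) * f 0%N x + t n * f n x))//.
by ring.
Unshelve. all: by end_near. Qed.

(** Capping the factors at [1] keeps boundedness and makes them weights of convex combinations. *)
Lemma potentially_bounded_scale F (f : nat -> L) : potentially_bounded F ->
  (forall n, F (f n)) -> exists2 t : R^nat, (forall n, 0 < t n <= 1) &
    forall x, exists M, forall n, `|t n * f n x| <= M.
Proof.
move=> Fpb /Fpb[t t0 /tvs_boundedP tb].
exists (fun n => Num.min (t n) 1) => [n|x].
  by rewrite lt_min t0 ltr01 ge_min lexx orbT.
have [M tM] := tb x; exists M => n.
have tMn : `|(t n *: f n) x| <= M by apply: tM; exists n.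
apply: le_trans tMn; have t0' := ltW (t0 n).
have m0 : 0 <= Num.min (t n) 1 by rewrite le_min t0' ler01.
by rewrite SCpZE !normrM ler_wpM2r// (ger0_norm m0) (ger0_norm t0') ge_min lexx.
Qed.

End SCp_theory.

(** * An open piece on which the whole family is continuous *)

Section common_continuity.
Import Order.TTheory GRing.Theory Num.Theory.
Import numFieldNormedType.Exports.
Local Open Scope ring_scope.
Variables (X : topologicalType) (R : realType).
Local Notation L := (SCp X R).
Implicit Types (A Q : set X) (x : X).
Hypothesis Xtight : countable_strong_fan_tightness X.

Lemma jump_subset A Q (f : X -> R) x e : A `<=` Q -> jump A f x e -> jump Q f x e.
Proof. by move=> AQ; apply: closure_subset => y [/AQ]. Qed.

(** A countable tree: tightness gives each node a sequence of children in [A] along which the jump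
    at the node is already visible. *)
Lemma countable_jump_set (F : set L) A : A !=set0 ->
  (forall x, A x -> exists2 f : L, F f & exists2 e, 0 < e & jump A f x e) ->
  exists (q : nat -> X) (f : nat -> L), [/\ forall n, A (q n), forall n, F (f n) &
    forall n, exists2 e, 0 < e & jump (range q) (f n) (q n) e].
Proof.
move=> [x0 Ax0] Aj.
have /choice[c cP] : forall x, exists c : L * (nat -> X), A x ->
    [/\ F c.1, forall n, A (c.2 n) & exists2 e, 0 < e & jump (range c.2) c.1 x e].
  move=> x; have [Ax|nAx] := pselect (A x); last by exists (0, fun=> x0).
  have [f Ff [e e0 fe]] := Aj x Ax.
  have [c Ac cx] := Xtight (fun=> fe).
  exists (f, c) => _; split=> //; first by move=> n; have [] := Ac n.
  exists e => //; apply: closure_subset cx => _ [n _ <-]; split; first by exists n.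
  by have [] := Ac n.
pose node := foldr (fun m x => (c x).2 m) x0.
have Anode s : A (node s) by elim: s => //= m s /cP[].
pose q n := node (odflt [::] (unpickle n)).
exists q, (fun n => (c (q n)).1); split=> n; first exact: Anode.
  by have [] := cP _ (Anode (odflt [::] (unpickle n))).
have [_ _ [e e0 je]] := cP _ (Anode (odflt [::] (unpickle n))).
exists e => //; apply: jump_subset je => _ [m _ <-].
by exists (pickle (m :: odflt [::] (unpickle n))) => //; rewrite /q pickleK.
Qed.

Lemma half_dominant (a : nat -> R) : (exists M, forall n, `|a n| <= M) ->
  exists k, forall n, `|a n| <= 2 * `|a k|.
Proof.
move=> [M aM]; have [a0|/existsNP[m /eqP am]] := pselect (forall n, a n = 0).
  by exists 0%N => n; rewrite a0 normr0 mulr_ge0.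
pose E := range (fun n => `|a n|).
have E_sup : has_sup E by split; [exists `|a m|, m|exists M => _ [n _ <-]].
have E_le n : `|a n| <= sup E by apply: sup_upper_bound => //; exists n.
have E0 : 0 < sup E / 2 by rewrite divr_gt0// (lt_le_trans _ (E_le m)) ?normr_gt0.
have [_ [k _ <-] ak] := sup_adherent E0 E_sup.
by exists k => n; apply: le_trans (E_le n) _; lra.
Qed.

(* If boundedness failed everywhere on [Q], strong fan tightness would allow the points
   of a countable tree in [Q] to be chosen with the values of [h] there overcoming the
   weights [16^-(j+1)] fixed in advance by the index [j] of the node. *)
Lemma locally_bounded_sums (h : nat -> X -> R) Q : Q !=set0 ->
  (forall x, exists M, forall n, `|h n x| <= M) ->
  (forall (k : nat -> nat) (l : R^nat), (forall n, 0 <= l n <= 2^-1 ^+ n.+1) ->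
    exists g : L, forall x, series (fun n => l n * h (k n) x) @ \oo --> g x) ->
  exists W : set X, [/\ open W, Q `&` W !=set0 &
    exists2 M, 0 < M & forall n y, Q y -> W y -> `|h n y| <= M].
Proof.
move=> [q0 Qq0] hb hsum; apply: contrapT => unb.
have big W y M : open W -> Q y -> W y ->
    exists z, [/\ Q z, W z & exists n, M < `|h n z|].
  move=> Wo Qy Wy; apply: contrapT => nz; apply: unb; exists W; split=> //.
    by exists y.
  exists (`|M| + 1) => [|n z Qz Wz]; first by rewrite ltr_wpDl.
  rewrite leNgt; apply/negP => Mz; apply: nz; exists z; split=> //; exists n.
  by apply: le_lt_trans Mz; rewrite (le_trans (ler_norm M))// lerDl.
pose pk (s : seq (nat * nat)) : R := 16^-1 ^+ (pickle s).+1.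
have pk0 s : 0 < pk s by rewrite exprn_gt0// invr_gt0.
(* The factor [10] pays for the [5] of [series_dominant_diagonal] and the [2] of [half_dominant]. *)
pose peak m s := [set z | Q z /\ exists n, 10 * m%:R < pk s * `|h n z|].
have bigpeak m s W y : open W -> Q y -> W y -> exists2 z, W z & peak m s z.
  move=> Wo Qy Wy; have [z [Qz Wz [n hn]]] := big W y ((pk s)^-1 * (10 * m%:R)) Wo Qy Wy.
  by exists z => //; split=> //; exists n; rewrite -ltr_pdivrMl.
have /choice[c cP] : forall t : X * (nat * seq (nat * nat)), exists c : nat -> X,
    Q t.1 -> (forall i, peak t.2.1 ((t.2.1, i) :: t.2.2) (c i)) /\ closure (range c) t.1.
  move=> [y [m s]] /=; have [Qy|nQy] := pselect (Q y); last by exists (fun=> q0).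
  (* A different set for each [i]: the code of a child, hence its weight, is known before its
     point. *)
  have cl i : closure (peak m ((m, i) :: s)) y.
    move=> B; rewrite nbhsE => -[W [Wo Wy] WB].
    by have [z Wz pz] := bigpeak m ((m, i) :: s) W y Wo Qy Wy; exists z; split=> //; exact: WB.
  by have [c pc cy] := Xtight cl; exists c.
pose node := fix node s := if s is (m, i) :: s' then c (node s', (m, s')) i else q0.
have Qnode s : Q (node s).
  by elim: s => //= -[m i] s /(cP (node s, (m, s)))[/(_ i)[]].
have /choice[K KP] : forall y, exists k, forall n, `|h n y| <= 2 * `|h k y|.
  by move=> y; exact: half_dominant.
pose p j := node (odflt [::] (unpickle j)).
(* Row [i] is a function half dominant at [p i], so each diagonal entry dominates its column. *)
have [l l01 lg] := @series_dominant_diagonal R (fun i j => h (K (p i)) (p j))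
  (fun i j => KP (p j) _).
have [g gE] := hsum (K \o p) l l01.
have {}lg s : pk s * `|h (K (node s)) (node s)| <= 5 * `|g (node s)|.
  have <- : p (pickle s) = node s by rewrite /p pickleK.
  exact: lg (g \o p) (fun j => gE (p j)) (pickle s).
have g_big m i s : m%:R < `|g (node ((m, i) :: s))|.
  have [/(_ i)[_ [n /= hn]] _] := cP (node s, (m, s)) (Qnode s).
  have [y ycE] : exists y, y = c (node s, (m, s)) i by eexists.
  have gle : pk ((m, i) :: s) * `|h (K y) y| <= 5 * `|g y|.
    by rewrite ycE; exact: lg ((m, i) :: s).
  suff: m%:R < `|g y| by rewrite ycE.
  have := ler_wpM2l (ltW (pk0 ((m, i) :: s))) (KP y n).
  by move: hn gle; rewrite -ycE; lra.
have [|_ [s _ <-] gc] := scatteredly_continuous_no_jump (A := range node)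
    (SCp_scatteredly_continuous g).
  by exists q0, [::].
have near_s := jumpPn (gc 1 ltr01).
(* The children of height [m] accumulate at [node s], and there [|g|] exceeds [|g (node s)| + 1]. *)
pose m := Num.bound (`|g (node s)| + 1).
have [_ /(_ _ near_s)[_ [[i _ <-]]]] := cP (node s, (m, s)) (Qnode s).
move=> /(_ (ex_intro2 _ _ ((m, i) :: s) I erefl)).
have := g_big m i s; have := @archi_boundP _ (`|g (node s)| + 1) (addr_ge0 (normr_ge0 _) ler01).
rewrite -/m => mlt glt; have := lerB_dist (g (node ((m, i) :: s))) (g (node s)).
move: mlt glt => /=; lra.
Qed.

(** Otherwise the discontinuity points [D] are dense in [A], and the jumps persist along [D] and
    along a countable part of it. Where the scaled functions are bounded, some sum in [SCp] jumps at
    every point. *)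
Lemma common_continuity (F : set L) A : potentially_bounded F -> infty_convex F ->
  A !=set0 -> exists W : set X, [/\ open W, A `&` W !=set0 &
    forall (f : L) x e, F f -> A x -> W x -> 0 < e -> ~ jump A f x e].
Proof.
move=> Fpb Fconv [a0 Aa0]; apply: contrapT => nW.
pose D := [set x | A x /\ exists2 f : L, F f & exists2 e, 0 < e & jump A f x e].
have Ddense W y : open W -> A y -> W y -> exists2 x, W x & D x.
  move=> Wo Ay Wy; apply: contrapT => nD; apply: nW; exists W; split=> //.
    by exists y.
  move=> f x e Ff Ax Wx e0 fe; apply: nD; exists x => //; split=> //.
  by exists f => //; exists e.
have Djump x : D x -> exists2 f : L, F f & exists2 e, 0 < e & jump D f x e.
  move=> [Ax [f Ff [e e0 fe]]]; exists f => //; exists (e / 2); first by rewrite divr_gt0.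
  move=> B; rewrite nbhsE => -[W [Wo Wx] WB].
  have [y [[Ay ey] Wy]] := fe W (open_nbhs_nbhs (conj Wo Wx)).
  (* If [y] is outside [D], then [f] varies by less than [e / 2] along [A] near [y], and a nearby
     point of [D] still differs by [e / 2]. *)
  have [Dy|nDy] := pselect (D y).
    by exists y; split; [split=> //=; move: ey => /=; lra|exact: WB].
  have /jumpPn : ~ jump A f y (e / 2).
    by move=> fy; apply: nDy; split=> //; exists f => //; exists (e / 2); rewrite ?divr_gt0.
  rewrite /prop_near1 nbhsE => -[V [oV Vy] Vf].
  have [z [Wz Vz] Dz] := Ddense (W `&` V) y (openI Wo oV) Ay (conj Wy Vy).
  exists z; split; last exact: WB.
  split=> //=; have := Vf z Vz Dz.1; rewrite distrC => fyz.
  by have := ler_distD (f z) (f y) (f x); move: ey fyz => /=; lra.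
have D0 : D !=set0 by have [x _ Dx] := Ddense setT a0 openT Aa0 I; exists x.
have [q [f [_ Ff fj]]] := countable_jump_set D0 Djump.
have [t t01 tf] := potentially_bounded_scale Fpb Ff.
pose h n x := t n * f n x.
have hsum (k : nat -> nat) (l : R^nat) : (forall n, 0 <= l n <= 2^-1 ^+ n.+1) ->
    exists g : L, forall x, series (fun n => l n * h (k n) x) @ \oo --> g x.
  apply: (@infty_convex_series X R F (f \o k) (t \o k)) => // [n|n|x].
  - exact: Ff.
  - exact: t01.
  - by have [M tM] := tf x; exists M => n; exact: tM.
have [|W [Wo [_ [[n0 _ <-] Wn0]] [M M0 hM]]] := locally_bounded_sums _ tf hsum (Q := range q).
  by exists (q 0%N), 0%N.
(* Indices of points outside [W] are redirected to [n0]. *)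
pose k n := if q n \in W then n else n0.
have Wk n : W (q (k n)) by rewrite /k; case: ifPn => // /set_mem.
have [|n||l l01 lj] := @series_jump X R (range q `&` W) (h \o k) (q \o k) M M0.
- by move=> n y [Qy Wy]; exact: hM.
- by split; [exists (k n)|exact: Wk].
- move=> n; have [e e0 fe] := fj (k n); have /andP[t0 _] := t01 (k n).
  exists (t (k n) * e); first by rewrite mulr_gt0.
  move=> B /(jump_open Wo (Wk n) fe)[y [[QWy /= ey] By]].
  exists y; split=> //; split=> //=.
  by rewrite /h -mulrBr normrM (gtr0_norm t0) ler_pM2l.
have [g gE] := hsum k l l01.
have [|x [[n _ <-] Wx] gx] := scatteredly_continuous_no_jump (A := range q `&` W)
    (SCp_scatteredly_continuous g).
  by exists (q n0); split=> //; exists n0.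
have [e e0] := lj g (fun y _ => gE y) n.
by rewrite /= /k mem_set//; exact: gx.
Qed.

End common_continuity.

(** * Transfinite iteration without ordinals *)

Section tower.
Variables (T : Type) (phi : set T -> set T).
Hypothesis phi_mono : forall V W, V `<=` W -> phi V `<=` phi W.

(** The empty family [C] yields the initial stage, and unions replace limit ordinals. *)
Inductive tower : set T -> Prop :=
| tower_succ W : tower W -> tower (phi W)
| tower_bigcup (C : set (set T)) : (forall W, C W -> tower W) ->
    tower (\bigcup_(W in C) W).

(** Double induction, where monotonicity carries comparisons to successors. At a union one half
    rests on the other, so both are proved together. *)
Lemma tower_succ_le V W : tower V -> tower W ->
  (phi V `<=` W \/ W `<=` V) /\ (phi W `<=` V \/ V `<=` W).
Proof.
have cup (C : set (set T)) (A B : set T) :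
    (forall c, C c -> A `<=` c \/ c `<=` B) ->
    A `<=` \bigcup_(c in C) c \/ \bigcup_(c in C) c `<=` B.
  move=> h; have [[c [Cc Ac]]|nc] := pselect (exists c, C c /\ A `<=` c).
    by left; apply: subset_trans Ac _; exact: bigcup_sup.
  right=> x [c Cc cx]; have [Ac|cB] := h c Cc; last exact: cB.
  by case: nc; exists c.
move=> tV; elim: tV W => {V} [V tV IHV|C tC IHC] W tW.
  elim: tW => {W} [W tW _|D tD IHD].
    by have [[h1|h1] [h2|h2]] := IHV W tW; split; (try by left; exact: phi_mono);
      right; exact: phi_mono.
  split; first by apply: cup => d /IHD[].
  have [DV|/existsNP[d /not_implyP[Dd dV]]] := pselect (forall d, D d -> d `<=` V).
    by left; apply: phi_mono => x [d /DV]; apply.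
  by right; have [[h|//] _] := IHV d (tD d Dd); apply: subset_trans h _; exact: bigcup_sup.
split; last first.
  by apply: cup => c Cc; have [] := IHC c Cc W tW.
elim: tW => {W} [W tW _|D tD IHD]; last exact: cup.
have [CW|/existsNP[c /not_implyP[Cc cW]]] := pselect (forall c, C c -> c `<=` W).
  by left; apply: phi_mono => x [c /CW]; apply.
by right; have [_ [h|//]] := IHC c Cc W tW; apply: subset_trans h _; exact: bigcup_sup.
Qed.

End tower.

(** * Weak discontinuity, and a network of the family *)

Section weak_discontinuity.
Import Order.TTheory GRing.Theory Num.Theory.
Import numFieldNormedType.Exports.
Local Open Scope ring_scope.
Variables (X : topologicalType) (R : realType) (F : set (SCp X R)).
Local Notation L := (SCp X R).
Implicit Types (A P W : set X) (x : X) (e : R).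

Let continuous_on A W :=
  forall (f : L) x e, F f -> A x -> W x -> 0 < e -> ~ jump A f x e.

Hypothesis F_continuous : forall A, A !=set0 -> exists W,
  [/\ open W, A `&` W !=set0 & continuous_on A W].

(** All open sets where [F] is continuous along [A] are united; density comes from [F_continuous] on
    the traces of [A] on open sets. *)
Lemma weakly_discontinuous_of_jump : weakly_discontinuous [set SCp_fun f | f in F].
Proof.
move=> A A0; pose W := \bigcup_(V in [set V | open V /\ continuous_on A V]) V.
exists (A `&` W); split=> [||x Ax B|_ [f Ff <-]]; first exact: subIsetl.
- apply/open_subspaceP; exists W; first by apply: bigcup_open => V [].
  by rewrite setIAC setIid setIC.
- rewrite nbhsE => -[V [Vo Vx] VB].
  have [|U [Uo [y [[Ay Vy] Uy]] Uc]] := @F_continuous (A `&` V); first by exists x.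
  exists y; split; last exact: VB.
  split=> //; exists (U `&` V) => //; split; first exact: openI.
  move=> f z e Ff Az [Uz Vz] e0 /(jump_open Vo Vz); exact: Uc.
- rewrite continuous_subspace_in => x /set_mem[Ax Wx].
  apply/continuous_jumpP => // e e0 /(jump_subset (@subIsetl _ A W)).
  by have [V [_ Vc] Vx] := Wx; exact: Vc.
Qed.

(** One round of peeling: what is added to [W] is the next layer. *)
Let phi W := W `|` \bigcup_(V in [set V | open V /\ continuous_on (~` W) V]) V.

Let phi_mono W V : W `<=` V -> phi W `<=` phi V.
Proof.
move=> WV x [Wx|[U [Uo Uc] Ux]]; first by left; exact: WV.
right; exists U => //; split=> // f y e Ff Vy Uy e0.
have VW : ~` V `<=` ~` W by exact: subsetC.
by move=> /(jump_subset VW); apply: Uc => //; exact: VW.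
Qed.

Let tower_open W : tower phi W -> open W.
Proof.
elim=> {W} [W _ oW|C _ oC]; last exact: bigcup_open.
by apply: openU => //; apply: bigcup_open => V [].
Qed.

(* The trace of [P] on the layer [phi W `\` W] for the largest stage [W] not containing
   [P]: one piece for each [P], so that the number of layers plays no role. *)
Definition core P := P `\` \bigcup_(W in [set W | tower phi W /\ ~ P `<=` W]) W.

(** The layer of [x] follows [Wx], the largest stage missing [x]. For a small [P] around [x] inside
    [phi Wx], [core P] is [P] minus [Wx], and there continuity along the complement of [Wx] controls
    [f]. *)
Lemma network_core N (f : L) x e : network N -> F f -> 0 < e ->
  exists2 P, N P & core P x /\ forall y, core P y -> `|f y - f x| < e.
Proof.
move=> Nnet Ff e0; pose Wx := \bigcup_(W in [set W | tower phi W /\ ~ W x]) W.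
have tWx : tower phi Wx by apply: tower_bigcup => W [].
have nWx : ~ Wx x by move=> [W []].
have phix : phi Wx x.
  (* Otherwise [phi Wx] would lie in [Wx], but [F_continuous] adds a point outside [Wx]. *)
  apply: contrapT => nphi; have phiW : phi Wx `<=` Wx.
    by move=> y phiy; exists (phi Wx) => //; split=> //; exact: tower_succ.
  have [|V [Vo [y [ny Vy]] Vc]] := @F_continuous (~` Wx); first by exists x.
  by apply: ny; apply: phiW; right; exists V.
have [//|[U [Uo Uc] Ux]] := phix.
have /jumpPn := Uc f x e Ff nWx Ux e0.
rewrite /prop_near1 nbhsE => -[V [Vo Vx] Vf].
have oVphi : open (V `&` phi Wx) by apply: openI => //; exact/tower_open/tower_succ.
have [P NP [Px PV]] := Nnet _ x oVphi (conj Vx phix).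
exists P => //; split.
  split=> // -[W [tW nPW] xW].
  have [[h|h] _] := tower_succ_le phi_mono tWx tW; last exact/nWx/h.
  by apply: nPW => y /PV[_ /h].
move=> y [Py nWy]; apply: Vf; first exact: (PV _ Py).1.
by move=> Wy; apply: nWy; exists Wx => //; split=> // /(_ x Px).
Qed.

Local Notation Y := (set_type F).

(** [p.2] codes a rational centre [q] and the radius [1/(n+1)]; a number coding no pair imposes no
    condition. *)
Let cell (p : set X * nat) : set Y := [set g | forall q n, unpickle p.2 = Some (q, n) ->
  forall y, core p.1 y -> `|(set_val g : L) y - ratr q| < (n.+1%:R : R)^-1].

Let box (s : seq (set X * nat)) : set Y := foldr (fun p B => cell p `&` B) setT s.

Let box_cat s t : box (s ++ t) = box s `&` box t.
Proof. by elim: s => [|p s IH] /=; rewrite ?setTI// IH setIA. Qed.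

Let codes (N : set (set X)) := [set s : seq (set X * nat) | all (fun p => p.1 \in N) s].

(** Concatenation of words makes the boxes around [f] a filter base, so pointwise convergence of
    this filter to [f] suffices. *)
Lemma network_box N : network N -> network (box @` codes N).
Proof.
move=> Nnet W f; rewrite openE => Wo /Wo Wf.
pose G : set_system Y := [set V | exists2 s, codes N s & box s f /\ box s `<=` V].
have FG : Filter G.
  split=> [|U V [s Ns [sf sU]] [t Nt [tf tV]]|U V UV [s Ns [sf sU]]].
  - by exists [::].
  - exists (s ++ t); first by rewrite /codes/= all_cat Ns.
    by rewrite box_cat; split=> // g [/sU ? /tV].
  - by exists s => //; split=> //; exact: subset_trans UV.
suff Gf : set_val @ G --> (set_val f : L).
  suff [s Ns [sf sW]] : G W by exists (box s); [exists s|split].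
  move: Wf; rewrite /interior => -[V [[U oU UV] Vf] VW].
  apply: filterS VW _; rewrite -UV; apply: Gf; apply: open_nbhs_nbhs; split=> //.
  by move: Vf; rewrite -UV.
apply/SCp_cvgP => x; apply/cvgrPdist_lt => e e0.
have Ff : F (set_val f) by exact: set_valP.
pose n := Num.bound (2 / e); pose d : R := n.+1%:R^-1.
have d0 : 0 < d by rewrite invr_gt0.
have de : 2 * d < e.
  rewrite ltr_pdivrMr// mulrC -ltr_pdivrMr//.
  apply: lt_le_trans (archi_boundP _) _; first by rewrite divr_ge0// ltW.
  by rewrite ler_nat.
have d2 : 0 < d / 2 by rewrite divr_gt0.
(* Oscillation and rational error, each below [d / 2], put [f] in the cell of radius [d], whose
   members differ from [f] at [x] by less than [2 * d]. *)
have [P NP [Px fP]] := network_core x Nnet Ff d2.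
have [|q] := @rat_in_itvoo R ((set_val f : L) x - d / 2) ((set_val f : L) x + d / 2).
  lra.
rewrite in_itv/= => /andP[q1 q2].
exists [:: (P, pickle (q, n))]; first by rewrite /codes/= mem_set.
have boxE g : box [:: (P, pickle (q, n))] g <->
    forall y, core P y -> `|(set_val g : L) y - ratr q| < d.
  split=> [[/(_ q n (pickleK _))//]|h]; split=> // q' n' /=.
  by rewrite pickleK => -[<- <-].
split=> [|g /boxE/(_ x Px)]; first apply/boxE => y /fP.
  by rewrite !ltr_norml; lra.
by rewrite /= distrC !ltr_norml; lra.
Qed.

Lemma card_codes N : codes N #<= words (inl @` N `|` range inr : set (set X + nat)).
Proof.
(* The closing [inr 0] gives even the empty word a non-empty code. *)
pose w := fix w (s : seq (set X * nat)) : seq (set X + nat) :=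
  if s is p :: s' then [:: inl p.1, inr p.2 & w s'] else [:: inr 0%N].
apply: (@card_leI _ _ _ _ w) => [s Ns|s t _ _].
  split; first by case: s {Ns}.
  elim: s Ns => [_|[P n] s IH /= /andP[/set_mem NP /IH ->]] /=.
    by rewrite mem_set//; right; exists 0%N.
  by rewrite !mem_set//; [right; exists n|left; exists P].
by elim: s t => [|[P n] s IH] [|[Q m] t]//= [-> -> /IH ->].
Qed.

End weak_discontinuity.

(** * Comparison of network weights *)

Lemma infinite_nw (Y : topologicalType) : infinite_set (nw Y).
Proof.
apply/infiniteP; apply: (@card_leI _ _ _ _ inr) => [n _|n m _ _ [->]]//.
by right; exists n.
Qed.

(** The two summands of [nw Y] become words of length one and two over [K], and an infinite [K]
    absorbs its words. *)
Lemma nw_le_network (Y : topologicalType) (T : Type) (K : set T) (N : set (set Y)) :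
  infinite_set K -> network N -> N #<= K -> nw Y #<= K.
Proof.
move=> Kinf Nnet NK; have [k0 Kk0] := infinite_setN0 Kinf.
have [_ Nmin] := @minimal_networkP Y.
have [f fK fI] := card_leE k0 (card_le_trans (Nmin _ Nnet) NK).
have [i iK iI] := card_leE k0 ((infiniteP _).1 Kinf).
apply: card_le_trans (card_words_infinite Kinf).
apply: (@card_leI _ _ _ _ (fun z => match z with inl A => [:: f A] | inr n => [:: i n; i n] end)).
  move=> _ [[A NA <-]|[n _ <-]]; split=> //=; rewrite !mem_set//.
  - exact: fK.
  - exact: iK.
move=> [A|n] [B|m] /set_mem[[A' NA' E]|[n' _ E]] /set_mem[[B' NB' E']|[m' _ E']]//=.
  case: E E' => <- [<-] [] /fI -> //; exact: mem_set.
by move=> [] /iI ->//; exact: mem_set.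
Qed.

Theorem theorem1p2 (R : realType) (X : topologicalType) (F : set (SCp X R)) :
  countable_strong_fan_tightness X ->
  potentially_bounded F ->
  infty_convex F ->
  weakly_discontinuous [set SCp_fun f | f in F] /\ nw (set_type F) #<= nw X.
Proof.
move=> Xtight Fpb Fconv.
have Fcont A := common_continuity (A := A) Xtight Fpb Fconv.
split; first exact: weakly_discontinuous_of_jump.
have [Nnet _] := @minimal_networkP X.
apply: nw_le_network (@infinite_nw X) (network_box Fcont Nnet) _.
apply: card_le_trans (card_image_le _ _) _.
(* For the minimal network of [X] the alphabet of [card_codes] is [nw X] itself. *)
exact: card_le_trans (card_codes _) (card_words_infinite (@infinite_nw X)).
Qed.
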